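(* Let $M\in C^1\left([0,T_{max});\mathbb{R}^{3\times 3}\right)$ satisfy, for all $t\in[0,T_{max})$, $$\partial_t M+M^2-\frac13\operatorname{tr}\left(M^2\right)I_3=0,\qquad \operatorname{tr}(M)=0,$$ and let $u(x,t)=M(t)x$ for $x\in\mathbb{R}^3$, $t\in[0,T_{max})$ (so that $u$ is a spatially linear solution of the Navier--Stokes equation, $u\in C^1([0,T_{max});C^\infty)$). Then $u$ is a classical solution of the Navier--Stokes equation (for every viscosity $\nu>0$) with pressure $$p(x,t)=-\frac16\operatorname{tr}\left(M(t)^2\right)|x|^2 .$$
   Context: The incompressible Navier--Stokes equations on $\mathbb{R}^3$ with viscosity $\nu>0$ are $$\partial_t u-\nu\Delta u+(u\cdot\nabla)u+\nabla p=0,\qquad \nabla\cdot u=0,$$ for a velocity $u(x,t)\in\mathbb{R}^3$ and a pressure $p(x,t)\in\mathbb{R}$. A classical solution is a pair $(u,p)$ of functions regular enough for these equations to hold pointwise, satisfying them at every point of $\mathbb{R}^3\times[0,T_{max})$; no decay at infinity is required. $I_3$ is the $3\times3$ identity matrix. *)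

(* Defs.v *)
From HB Require Import structures.
From mathcomp Require Import all_boot all_order all_algebra.
From mathcomp Require Import all_classical all_reals all_analysis.

Set Implicit Arguments.
Unset Strict Implicit.
Unset Printing Implicit Defensive.
Import Order.TTheory GRing.Theory Num.Theory.
Import numFieldNormedType.Exports.
Local Open Scope classical_set_scope.
Local Open Scope ring_scope.

(* The lifespan [0, T) of a solution; T = +oo is allowed. *)
Definition lifespan (R : realType) (T : \bar R) : set R :=
  [set t | 0 <= t /\ (t%:E < T)%E].

(* Time is restricted to [0, T), so the limit is one-sided at t = 0 and the
   values of f outside [0, T) never matter. *)
Definition time_quot (R : realType) (V : lmodType R) (f : R -> V) (t s : R) : V :=
  (s - t)^-1 *: (f s - f t).

Definition time_derivable (R : realType) (V : normedModType R) (T : \bar R)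
    (f : R -> V) (t : R) : Prop :=
  cvg (time_quot f t @ within (lifespan T) t^').

Definition time_derive (R : realType) (V : normedModType R) (T : \bar R)
    (f : R -> V) (t : R) : V :=
  lim (time_quot f t @ within (lifespan T) t^').

Definition C1_time (R : realType) (V : normedModType R) (T : \bar R)
    (f : R -> V) : Prop :=
  (forall t, lifespan T t -> time_derivable T f t) /\
  {within lifespan T, continuous (time_derive T f)}.

Section Space.
Context (R : realType).
Implicit Types (u v : 'cV[R]_3 -> 'cV[R]_3) (p : 'cV[R]_3 -> R).

Definition pd (W : normedModType R) (i : 'I_3) (f : 'cV[R]_3 -> W) :
    'cV[R]_3 -> W :=
  'D_(delta_mx i 0) f.

Definition divergence u (x : 'cV[R]_3) : R := \sum_i pd i u x i 0.

Definition gradient p (x : 'cV[R]_3) : 'cV[R]_3 := \col_i pd i p x.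

Definition laplacian u (x : 'cV[R]_3) : 'cV[R]_3 := \sum_i pd i (pd i u) x.

(* (u . grad) v *)
Definition convection u v (x : 'cV[R]_3) : 'cV[R]_3 :=
  \sum_j u x j 0 *: pd j v x.

(* The library norm on column vectors is the sup norm; this is the square of
   the Euclidean one. *)
Definition sqr_euclid (x : 'cV[R]_3) : R := \sum_i x i 0 ^+ 2.

Definition classical_solution (nu : R) (T : \bar R)
    (u : R -> 'cV[R]_3 -> 'cV[R]_3) (p : R -> 'cV[R]_3 -> R) : Prop :=
  forall (t : R) (x : 'cV[R]_3), lifespan T t ->
    [/\ [/\ time_derivable T (u ^~ x) t,
            differentiable (u t) x,
            forall i, differentiable (pd i (u t)) x
          & differentiable (p t) x],
        time_derive T (u ^~ x) t - nu *: laplacian (u t) x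
          + convection (u t) (u t) x + gradient (p t) x = 0
      & divergence (u t) x = 0].

Definition iter_pd (s : seq 'I_3) u : 'cV[R]_3 -> 'cV[R]_3 :=
  foldr (fun i f => pd i f) u s.

Definition smooth u : Prop :=
  forall (s : seq 'I_3) (x : 'cV[R]_3), differentiable (iter_pd s u) x.

(* Convergence in the Frechet space C^oo(R^3; R^3): every iterated partial
   derivative converges uniformly on compact sets. *)
Definition smooth_cvg (F : set_system ('cV[R]_3 -> 'cV[R]_3)) u : Prop :=
  forall s : seq 'I_3, {family compact, iter_pd s @ F --> iter_pd s u}.

(* C^1([0, T); C^oo(R^3; R^3)); v is the time derivative of u. *)
Definition C1_smooth (T : \bar R) (u : R -> 'cV[R]_3 -> 'cV[R]_3) : Prop :=
  exists v : R -> 'cV[R]_3 -> 'cV[R]_3,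
    forall t, lifespan T t ->
      [/\ smooth (u t), smooth (v t),
          smooth_cvg (time_quot u t @ within (lifespan T) t^') (v t)
        & smooth_cvg (v @ within (lifespan T) (nbhs t)) (v t)].

End Space.

(* Main.v *)
Require Import Defs.
From HB Require Import structures.
From mathcomp Require Import all_boot all_order all_algebra.
From mathcomp Require Import all_classical all_reals all_analysis.
From mathcomp Require Import ring.

Import Order.TTheory GRing.Theory Num.Theory.
Import numFieldNormedType.Exports.
Local Open Scope classical_set_scope.
Local Open Scope ring_scope.

(** For a velocity that is linear in space the Navier-Stokes equations reduce to
    an equation between matrices applied to [x]. The Laplacian of [M x] vanishes,
    which is why one velocity serves every viscosity; the divergence is the trace of [M]; the
    convection term is [M (M x)] ([convection_mulmx]); and the gradient of the
    squared Euclidean norm is [2 x] ([gradient_sqr_euclid]), so the pressure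
    gradient is [- 1/3 tr (M^2) x]. Their sum is the matrix differential equation
    applied to [x].

    The regularity claim asks for convergence of all space derivatives, uniformly
    on compact sets, of the difference quotients in time and of the time
    derivative. The difference quotient of [M x] is the difference quotient of
    [M], applied to [x], so both are instances of one fact: if matrices [A t]
    converge to [B], then the fields [A t x] converge to [B x] in that topology
    ([smooth_cvg_mulmx]). It holds because [A] factors out of every iterated
    derivative of [A x] ([iter_pd_mulmx]), leaving a field that does not depend
    on [A] and is bounded on compact sets.

    To identify the time derivative of [M t x] one needs uniqueness of
    limits along times in [0, T) different from [t]
    ([lifespan_dnbhs_proper]). *)

(** * Norm and continuity of the matrix product *)

(** The factor [n] is the price of the sup norm, which is not submultiplicative:
    an entry of the product is a sum of [n] terms. *)
Lemma mx_norm_mulmx (R : realType) m n p (A : 'M[R]_(m, n)) (B : 'M[R]_(n, p)) :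
  `|A *m B| <= n%:R * `|A| * `|B|.
Proof.
rewrite [leLHS]/Num.Def.normr/= mx_normrE; apply: bigmax_le => [|[i j] _].
  by rewrite !mulr_ge0.
have le_entry a b (C : 'M[R]_(a, b)) k l : `|C k l| <= `|C|.
  rewrite [leRHS]/Num.Def.normr/= mx_normrE.
  exact: (le_bigmax _ (fun i => `|C i.1 i.2|) (k, l)).
rewrite mxE (le_trans (ler_norm_sum _ _ _))//.
have -> : n%:R * `|A| * `|B| = \sum_(k < n) `|A| * `|B|.
  by rewrite sumr_const card_ord -mulrA mulr_natl.
by apply: ler_sum => k _; rewrite normrM ler_pM.
Qed.

Lemma linear_le_norm_continuous (R : realType) (V W : normedModType R)
    (f : {linear V -> W}) (k : R) :
  (forall x, `|f x| <= k * `|x|) -> continuous f.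
Proof.
move=> fk; apply/linear_bounded_continuous/linear_boundedP.
by near=> r => x; rewrite (le_trans (fk x))// ler_wpM2r.
Unshelve. all: by end_near. Qed.

Lemma continuous_mulmx (R : realType) m n p (A : 'M[R]_(m, n)) :
  continuous (mulmx A : 'M[R]_(n, p) -> 'M[R]_(m, p)).
Proof. exact/linear_le_norm_continuous/mx_norm_mulmx. Qed.

(** This carries the limit of the difference quotients of [M] at a point to
    those of [M t *m x], for [x] fixed. *)
Lemma continuous_mulmxr (R : realType) m n p (B : 'M[R]_(n, p)) :
  continuous (mulmxr B : 'M[R]_(m, n) -> 'M[R]_(m, p)).
Proof.
apply: (@linear_le_norm_continuous _ _ _ _ (n%:R * `|B|)) => A /=.
by rewrite mulrAC mx_norm_mulmx.
Qed.

(** * Linear velocity fields and quadratic pressures *)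

Section Spatial.
Context {R : realType}.
Implicit Types (A B : 'M[R]_3) (x c : 'cV[R]_3) (s : seq 'I_3) (i : 'I_3).

Lemma differentiable_mulmx A x : differentiable (mulmx A) x.
Proof. exact/linear_differentiable/continuous_mulmx. Qed.

Lemma pd_mulmx A i : pd i (mulmx A) = cst (A *m delta_mx i 0).
Proof.
apply/funext => x; rewrite /pd deriveE; last exact: differentiable_mulmx.
by rewrite diff_lin //; exact: continuous_mulmx.
Qed.

Lemma pd_cst i c : pd i (cst c) = cst 0.
Proof. by apply/funext => x; exact: derive_cst. Qed.

(** Differentiating the identity once gives a basis vector and then zero; these
    two shapes are all that boundedness on compact sets and differentiability
    depend on. *)
Lemma iter_pd_id s : @iter_pd R s id = id \/ exists c, @iter_pd R s id = cst c.
Proof.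
elim: s => [|i s [] /= IH]; first by left.
  by right; exists (delta_mx i 0); rewrite IH; apply/funext => x; exact: derive_id.
by right; case: IH => c IH; exists 0; rewrite IH pd_cst.
Qed.

(** The coefficient matrix factors out of every iterated derivative, so that all
    of them depend on [A] linearly, through one vector field independent of
    [A]. *)
Lemma iter_pd_mulmx A s : iter_pd s (mulmx A) = mulmx A \o @iter_pd R s id.
Proof.
elim: s => [//|i s /= ->].
have [-> | [c ->]] := iter_pd_id s.
  rewrite pd_mulmx; apply/funext => x /=.
  by rewrite /pd derive_id.
have -> : mulmx A \o cst c = cst (A *m c) by [].
by rewrite !pd_cst; apply/funext => x /=; rewrite mulmx0.
Qed.

Lemma smooth_mulmx A : smooth (mulmx A).
Proof.
move=> s x; rewrite iter_pd_mulmx.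
have [-> | [c ->]] := iter_pd_id s; first exact: differentiable_mulmx.
exact: (differentiable_cst (A *m c)).
Qed.

Lemma iter_pd_id_bounded s (K : set 'cV[R]_3) : compact K ->
  exists2 C : R, 0 < C & forall x, K x -> `|@iter_pd R s id x| <= C.
Proof.
move=> /compact_bounded[r [_ bK]].
have [-> | [c ->]] := iter_pd_id s; last first.
  by exists (`|c| + 1); rewrite ?ltr_wpDl// => x _; rewrite lerDl.
exists (`|r| + 1); first by rewrite ltr_wpDl.
by move=> x; apply: bK; rewrite (le_lt_trans (ler_norm _))// ltrDl.
Qed.

(** On a compact set the field [iter_pd s id] is bounded by some [C], so the
    derivatives of [A t *m x] and [B *m x] differ there by at most
    [3 * `|B - A t| * C]: convergence of the matrices is enough for convergence
    of all derivatives, locally uniformly. *)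
Lemma smooth_cvg_mulmx (T : Type) (G : set_system T) {FG : Filter G}
    (A : T -> 'M[R]_3) B : A t @[t --> G] --> B ->
  smooth_cvg ((fun t => mulmx (A t)) @ G) (mulmx B).
Proof.
move=> AB s; apply/fam_cvgP => K cK P /uniform_nbhs[E [entE EP]].
have [C C0 KC] := iter_pd_id_bounded s K cK.
move: entE; rewrite -entourage_ballE => -[e /= e0 eE].
rewrite /nbhs /= /fmap/=; near=> t; apply: EP => x Kx; apply: eE => /=.
rewrite !iter_pd_mulmx /= -ball_normE /= -mulmxBl.
apply: (le_lt_trans (mx_norm_mulmx _ _ _ _ _ _)).
apply: (@le_lt_trans _ _ (3%:R * `|B - A t| * C)).
  by rewrite ler_wpM2l ?KC// mulr_ge0.
rewrite mulrAC mulrC -ltr_pdivlMr; last by rewrite mulr_gt0.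
near: t; apply: cvgr_dist_lt => //; by rewrite divr_gt0 // mulr_gt0.
Unshelve. all: by end_near. Qed.

(** The derivative of [B *m x] in direction [j] is column [j] of [B], and a matrix
    applied to a vector combines the columns with the entries of the vector. *)
Lemma convection_mulmx A B x : convection (mulmx A) (mulmx B) x = B *m (A *m x).
Proof.
rewrite /convection [X in _ = B *m X]matrix_sum_delta mulmx_sumr.
apply: eq_bigr => j _; by rewrite big_ord1 pd_mulmx /= scalemxAr.
Qed.

Lemma laplacian_mulmx A x : laplacian (mulmx A) x = 0.
Proof.
by rewrite /laplacian big1// => i _; rewrite pd_mulmx pd_cst.
Qed.

Lemma divergence_mulmx A x : divergence (mulmx A) x = \tr A.
Proof.
rewrite /divergence /mxtrace; apply: eq_bigr => i _.
by rewrite pd_mulmx /= -colE mxE.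
Qed.

(** The derivation rules for sums and powers are stated for pointwise operations
    on functions. *)
Lemma sqr_euclid_sumE :
  @sqr_euclid R = \sum_i (fun y : 'cV[R]_3 => y i 0) ^+ 2.
Proof. by apply/funext => y; rewrite fct_sumE. Qed.

Lemma differentiable_sqr_euclid x : differentiable (@sqr_euclid R) x.
Proof.
rewrite sqr_euclid_sumE; apply: differentiable_sum => i.
exact/differentiableX/differentiable_coord.
Qed.

(** A coordinate is an entry of the identity map, whose derivative along a vector
    is that vector. *)
Lemma pd_coord i j x : pd i (fun y : 'cV[R]_3 => y j 0) x = (j == i)%:R.
Proof.
rewrite /pd; have /= := @derive_mx R _ 3 1 id x (delta_mx i 0) (@derivable_id _ _ _ _).
by rewrite derive_id => /matrixP/(_ j 0); rewrite !mxE eqxx andbT.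
Qed.

Lemma gradient_sqr_euclid x : gradient (@sqr_euclid R) x = 2 *: x.
Proof.
have dc j v : derivable (fun y : 'cV[R]_3 => y j 0) x v.
  exact/diff_derivable/differentiable_coord.
apply/colP => i; rewrite !mxE /pd sqr_euclid_sumE.
rewrite derive_sum => [|j]; last exact: derivableX.
rewrite (bigD1 i)//= big1 => [|j /negPf ji].
  by rewrite addr0 deriveX// -/(pd _ _ _) pd_coord eqxx expr1 scaler1 mulr_natl.
by rewrite deriveX// -/(pd _ _ _) pd_coord ji scaler0.
Qed.

Lemma gradientZ (a : R) (p : 'cV[R]_3 -> R) x : differentiable p x ->
  gradient (fun y => a * p y) x = a *: gradient p x.
Proof.
move=> dp; apply/colP => i; rewrite !mxE /pd.
by rewrite (deriveZ a) //; exact: diff_derivable.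
Qed.

End Spatial.

(** * Limits along the lifespan *)

(** Limits of difference quotients in time are unique because every time of
    [0, T) is a limit of later times of [0, T); it is the later times that
    matter, since there are no earlier ones at [t = 0]. *)
Lemma lifespan_dnbhs_proper (R : realType) (T : \bar R) (t : R) :
  lifespan T t -> ProperFilter (within (lifespan T) t^').
Proof.
move=> [t0 tT]; apply: Build_ProperFilter_ex => P.
rewrite /within /= => -[e /= e0 eP].
(* When [T] is finite, go half of the way to the nearer of [T] and [t + e]. *)
have [r [tr re rT]] : exists r, [/\ t < r, r < t + e & (r%:E < T)%E].
  move: T tT {eP} => [T| |]//=.
    rewrite lte_fin => tT; exists (t + Num.min (T - t) e / 2).
    have m0 : 0 < Num.min (T - t) e by rewrite lt_min subr_gt0 tT.
    have m2 : Num.min (T - t) e / 2 < Num.min (T - t) e.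
      by rewrite ltr_pdivrMr// ltr_pMr// ltr1n.
    split; first by rewrite ltrDl divr_gt0.
      by rewrite ltrD2l (lt_le_trans m2)// ge_min lexx orbT.
    by rewrite lte_fin -ltrBrDl (lt_le_trans m2)// ge_min lexx.
  move=> _; exists (t + e / 2); split; rewrite ?ltry//.
    by rewrite ltrDl divr_gt0.
  by rewrite ltrD2l ltr_pdivrMr// ltr_pMr// ltr1n.
exists r; apply: eP => /=.
- by rewrite distrC ger0_norm ?subr_ge0 ?(ltW tr)// ltrBlDl.
- by rewrite gt_eqF.
- by split => //; rewrite (le_trans t0)// ltW.
Qed.

Theorem proposition1p2 (R : realType) (Tmax : \bar R) (M : R -> 'M[R]_3)
  (hTmax : (0 < Tmax)%E)
  (hM : C1_time Tmax M)
  (hode : forall t : R, lifespan Tmax t ->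
     time_derive Tmax M t + M t *m M t
       - (3%:R^-1 * \tr (M t *m M t)) *: 1%:M = 0)
  (htr : forall t : R, lifespan Tmax t -> \tr (M t) = 0) :
  let u : R -> 'cV[R]_3 -> 'cV[R]_3 := fun t x => M t *m x in
  let p : R -> 'cV[R]_3 -> R :=
    fun t x => - 6%:R^-1 * \tr (M t *m M t) * sqr_euclid x in
  C1_smooth Tmax u /\
  (forall nu : R, 0 < nu -> classical_solution nu Tmax u p).
Proof.
move=> u p; have [dM cM] := hM.
have quotE t x s : time_quot (u ^~ x) t s = time_quot M t s *m x.
  by rewrite /time_quot /u -mulmxBl scalemxAl.
split.
  exists (fun t => mulmx (time_derive Tmax M t)) => t tT; split.
  - exact: smooth_mulmx.
  - exact: smooth_mulmx.
  - have -> : time_quot u t = fun s => mulmx (time_quot M t s).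
      by apply/funext => s; apply/funext => x; rewrite -quotE.
    by apply: smooth_cvg_mulmx; exact: dM.
  - apply: smooth_cvg_mulmx.
    by move/subspace_continuousP : cM => /(_ t tT).
move=> nu _ t x tT.
have PF := lifespan_dnbhs_proper _ _ _ tT.
have ux : time_quot (u ^~ x) t s @[s --> within (lifespan Tmax) t^']
    --> time_derive Tmax M t *m x.
  under eq_fun do rewrite quotE.
  exact: (cvg_comp _ _ (dM t tT) (@continuous_mulmxr _ _ _ _ x _)).
have dux : time_derive Tmax (u ^~ x) t = time_derive Tmax M t *m x.
  exact: cvg_lim ux.
have dsq := differentiable_sqr_euclid x.
split.
- split.
  + by apply/cvg_ex; eexists; exact: ux.
  + exact: differentiable_mulmx.
  + move=> i; exact: (smooth_mulmx (M t) [:: i]).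
  + exact: differentiableZ.
- rewrite dux laplacian_mulmx scaler0 subr0 convection_mulmx gradientZ//.
  rewrite gradient_sqr_euclid mulmxA -mulmxDl scalerA.
  (* Differentiating the squared norm gives the factor 2, which turns 1/6 into
     the coefficient 1/3 of the matrix equation. *)
  have -> : - 6%:R^-1 * \tr (M t *m M t) * 2 = - (3%:R^-1 * \tr (M t *m M t)).
    by field.
  by rewrite -mul_scalar_mx -mulmxDl -scalemx1 scaleNr hode// mul0mx.
- by rewrite divergence_mulmx htr.
Qed.
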